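(* Let $1\le p,q<\infty$, let $0<T<\infty$ and $I=(0,T)$. Let $X_1\subset X_2\subset X_3$ be real Banach spaces such that $X_1$ is reflexive, the embedding $X_1\subset X_2$ is compact and the embedding $X_2\subset X_3$ is continuous. If a subset $\mathcal{G}\subset M^{p,q}(I;X_1,X_3)$ is bounded, then it is relatively compact in $L^p(I;X_2)$.
   Context: For a Banach space $X$ and $1\le q<\infty$, let $\mathcal{F}$ be the family of all finite partitions $\pi$ of $I=(0,T)$ into disjoint subintervals $\sigma_i=(a_i,b_i)$ with $\bar I=\bigcup_{i=1}^n\bar\sigma_i$, and define the seminorm $\|x\|_{BV^q(I;X)}$ by $$\|x\|_{BV^q(I;X)}^q=\sup_{\pi\in\mathcal{F}}\Big\{\sum_{\sigma_i\in\pi}\|x(b_i)-x(a_i)\|_X^q\Big\}.$$ $BV^q(I;X)$ denotes the functions for which this is finite (pointwise values on $[0,T]$ are used). For Banach spaces $X\subset Z$, $M^{p,q}(I;X,Z)=L^p(I;X)\cap BV^q(I;Z)$ with norm $\|\cdot\|_{L^p(I;X)}+\|\cdot\|_{BV^q(I;Z)}$; boundedness of $\mathcal{G}$ is with respect to this norm. *)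

(* Defs.v *)
From HB Require Import structures.
From mathcomp Require Import all_boot all_order all_algebra.
From mathcomp Require Import ring_quotient.
From mathcomp Require Import all_classical all_reals all_analysis.
From mathcomp Require Import measurable_realfun.

Set Implicit Arguments.
Unset Strict Implicit.
Unset Printing Implicit Defensive.
Import Order.TTheory GRing.Theory Num.Theory.
Import numFieldNormedType.Exports.
Local Open Scope classical_set_scope.
Local Open Scope ring_scope.

Section Dual.
Context (R : realType) (X : normedModType R).

Definition dual_pred : {pred X -> R} :=
  mem [set f : X -> R | linear f /\ continuous f].

Record dual := Dual { dual_fun :> X -> R ; _ : dual_fun \in dual_pred }.

HB.instance Definition _ := [isSub for dual_fun].
HB.instance Definition _ := [Choice of dual by <:].

Lemma dual_submod_closed : submod_closed dual_pred.
Proof.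
split=> [|a f g]; rewrite !inE /=.
  split; first by move=> a x y; change (0 = a * 0 + 0 :> R); rewrite mulr0 addr0.
  exact: cst_continuous.
move=> [lf cf] [lg cg]; split.
  move=> b x y; rewrite -[LHS]/(a * f (b *: x + y) + g (b *: x + y)) lf lg.
  rewrite -[RHS]/(b * (a * f x + g x) + (a * f y + g y)).
  by rewrite -![_ *: _]/(_ * _) !mulrDr mulrCA addrACA.
move=> x; apply: (@cvgD _ R _ (nbhs x) _ (a *: f) g (a *: f x) (g x)); last exact: cg.
by apply: cvgZl_tmp; exact: cf.
Qed.

HB.instance Definition _ := GRing.isSubmodClosed.Build _ _ dual_pred
  dual_submod_closed.
HB.instance Definition _ := [SubChoice_isSubLmodule of dual by <:].

Definition dual_norm (f : dual) : R :=
  sup [set `|f x| | x in [set x | `|x| <= 1]].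

Lemma dual_linear (f : dual) : linear f.
Proof. by have := valP f; rewrite inE => -[]. Qed.

Lemma dual_has_sup (f : dual) : has_sup [set `|f x| | x in [set x | `|x| <= 1]].
Proof.
split; first by exists `|f 0|, 0 => //=; rewrite normr0.
have := valP f; rewrite inE => -[/= lf cf].
pose F : {linear X -> R} := HB.pack (dual_fun f) (GRing.isLinear.Build _ _ _ _ _ lf).
have /linear_boundedP/pinfty_ex_gt0[M M0 FM] : bounded_near F (nbhs 0).
  exact/continuous_linear_bounded/cf.
exists M => _ [x /= x1 <-]; apply: (le_trans (FM x)).
by rewrite ler_piMr // ltW.
Qed.

Lemma le_dual_norm (f : dual) x : `|x| <= 1 -> `|f x| <= dual_norm f.
Proof. by move=> x1; apply: sup_upper_bound; [exact: dual_has_sup|exists x]. Qed.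

Lemma dual_norm_le (f : dual) M :
  (forall x, `|x| <= 1 -> `|f x| <= M) -> dual_norm f <= M.
Proof.
move=> fM; apply: ge_sup; first by case: (dual_has_sup f).
by move=> _ [x /= x1 <-]; exact: fM.
Qed.

Lemma ler_dual_normD (f g : dual) : dual_norm (f + g) <= dual_norm f + dual_norm g.
Proof.
apply: dual_norm_le => x x1; rewrite -[X in `|X|]/(f x + g x).
by apply: (le_trans (ler_normD _ _)); apply: lerD; exact: le_dual_norm.
Qed.

Lemma dual_normZ (a : R) (f : dual) : dual_norm (a *: f) = `|a| * dual_norm f.
Proof.
have leZ b (g : dual) : dual_norm (b *: g) <= `|b| * dual_norm g.
  apply: dual_norm_le => x x1; rewrite -[X in `|X| <= _]/(b * g x) normrM.
  by apply: ler_wpM2l => //; exact: le_dual_norm.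
apply/eqP; rewrite eq_le leZ /=.
have [->|a0] := eqVneq a 0.
  rewrite normr0 mul0r; apply: (le_trans (normr_ge0 ((0 *: f) 0))).
  by apply: le_dual_norm; rewrite normr0.
rewrite -ler_pdivlMl ?normr_gt0 // -normfV.
by apply: le_trans (leZ _ _); rewrite scalerA mulVf // scale1r.
Qed.

Lemma dual_norm_eq0 (f : dual) : dual_norm f = 0 -> f = 0.
Proof.
move=> f0; apply/val_inj/funext => x /=.
have f00 : f 0 = 0.
  have := dual_linear f (-1) 0 0.
  by rewrite scaler0 addr0 -[_ *: _]/(_ * _) mulN1r addNr.
have [->//|x0] := eqVneq x 0.
have : `|f (`|x|^-1 *: x)| <= 0.
  rewrite -f0; apply: le_dual_norm.
  by rewrite normrZ normfV normr_id mulVf ?normr_eq0.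
rewrite normr_le0 => /eqP.
have := dual_linear f (`|x|^-1) x 0; rewrite addr0 f00 addr0 => -> /eqP.
by rewrite mulf_eq0 invr_eq0 normr_eq0 (negbTE x0) => /eqP.
Qed.

HB.instance Definition _ := Lmodule_isNormed.Build R dual
  ler_dual_normD dual_normZ dual_norm_eq0.

End Dual.

Definition reflexive_space (R : realType) (X : normedModType R) : Prop :=
  forall Phi : dual (dual X), exists x : X, forall f : dual X, Phi f = f x.

Section SimpleFunctions.
Context (R : realType).

(* Measurability is with respect to the Borel sets, and strongly_measurable
   below asks for convergence at every point of I. Every class of functions that
   are a.e. limits of simple functions has such a representative. *)
Definition simple_fun (X : Type) (s : R -> X) : Prop :=
  finite_set (range s) /\ forall y : X, measurable (s @^-1` [set y]).

Lemma simple_fun_preimage (X : Type) (s : R -> X) (A : set X) :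
  simple_fun s -> measurable (s @^-1` A).
Proof.
move=> [fs ms].
have -> : s @^-1` A = \bigcup_(y in range s `&` A) (s @^-1` [set y]).
  apply/seteqP; split=> t /=; first by move=> At; exists (s t) => //; split=> //; exists t.
  by move=> [y [_ Ay] ->].
by apply: fin_bigcup_measurable => //; exact: finite_setIl.
Qed.

Lemma simple_fun_comp2 (X Y Z : Type) (g : X -> Y -> Z) (s : R -> X) (r : R -> Y) :
  simple_fun s -> simple_fun r -> simple_fun (fun t => g (s t) (r t)).
Proof.
move=> ss sr; split.
  apply: sub_finite_set (finite_image2 g ss.1 sr.1).
  by move=> _ [t _ <-]; exists (s t); [exists t|exists (r t); [exists t|]].
move=> z.
have -> : (fun t => g (s t) (r t)) @^-1` [set z] =
   \bigcup_(x in range s) (s @^-1` [set x] `&` r @^-1` [set y | g x y = z]).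
  apply/seteqP; split=> t /=; first by move=> gz; exists (s t) => //; exists t.
  by move=> [x _ [/= <-]].
apply: fin_bigcup_measurable; first exact: ss.1.
by move=> x _; apply: measurableI; [exact: ss.2|exact: simple_fun_preimage].
Qed.

Lemma simple_fun_cst (X : Type) (x : X) : simple_fun (fun _ : R => x).
Proof.
split; first by apply: sub_finite_set (finite_set1 x) => _ [t _ <-].
by move=> y; rewrite preimage_cst; case: ifP.
Qed.

Lemma simple_fun_measurable (s : R -> R) : simple_fun s -> measurable_fun setT s.
Proof. by move=> ss _ B _; rewrite setTI; exact: simple_fun_preimage. Qed.

End SimpleFunctions.

Section BochnerLp.
Context (R : realType) (X : normedModType R) (T p : R).

Local Notation mu := (@lebesgue_measure R).
Local Notation I := `]0, T[%classic.

Definition strongly_measurable (u : R -> X) : Prop :=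
  exists s : nat -> R -> X, (forall n, simple_fun (s n)) /\
    forall t, I t -> s n t @[n --> \oo] --> u t.

Definition Lp_norm (u : R -> X) : \bar R :=
  ((\int[mu]_(t in I) (`|u t| `^ p)%:E) `^ p^-1)%E.

Lemma strongly_measurable_norm u :
  strongly_measurable u -> measurable_fun I (fun t => `|u t|).
Proof.
move=> [s [ss su]].
apply: (@measurable_fun_cvg _ _ _ _ (fun n t => `|s n t|)).
  move=> n; apply: (@measurable_funS _ _ _ _ setT) => //.
  apply: simple_fun_measurable.
  exact: (simple_fun_comp2 (fun x _ => `|x|) (ss n) (simple_fun_cst R tt)).
by move=> t It; apply: cvg_norm; exact: su.
Qed.

Lemma strongly_measurableZD a u v : strongly_measurable u -> strongly_measurable v ->
  strongly_measurable (a *: u + v).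
Proof.
move=> [s [ss su]] [r [sr rv]]; exists (fun n t => a *: s n t + r n t); split.
  by move=> n; exact: (simple_fun_comp2 (fun x y => a *: x + y)).
by move=> t It; apply: cvgD; [apply: cvgZl_tmp; exact: su|exact: rv].
Qed.

Context (p1 : 1 <= p).
Let p0 : 0 < p. Proof. exact: lt_le_trans p1. Qed.

Lemma Lp_norm_ge0 u : (0 <= Lp_norm u)%E.
Proof. exact: poweR_ge0. Qed.

Lemma Lp_normE u :
  Lp_norm u = ('N[mu]_p%:E[EFin \o ((fun t => `|u t|%R) \_ I)])%E.
Proof.
rewrite /Lp_norm unlock; congr (_ `^ _)%E; rewrite [LHS]integral_mkcond.
apply: eq_integral => t _; rewrite /= patchE [in RHS]patchE.
case: ifP => _ /=; first by rewrite normr_id.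
by rewrite normr0 powR0// gt_eqF.
Qed.

Lemma Lp_normD u v : strongly_measurable u -> strongly_measurable v ->
  (Lp_norm (u + v)%R <= Lp_norm u + Lp_norm v)%E.
Proof.
move=> mu_ mv.
have mI : measurable (I : set R) by exact: measurable_itv.
have mr w : strongly_measurable w -> measurable_fun setT ((fun t => `|w t|) \_ I).
  by move=> mw; apply/(measurable_restrictT _ _).1 => //; exact: strongly_measurable_norm.
rewrite (Lp_normE u) (Lp_normE v).
apply: le_trans (@minkowski_EFin _ _ _ mu _ _ p (mr u mu_) (mr v mv) p1).
have muv : strongly_measurable (u + v).
  by have := strongly_measurableZD 1 mu_ mv; rewrite scale1r.
have mp (f : R -> R) : measurable_fun setT f ->
    measurable_fun setT (fun t => `|(EFin \o f) t| `^ p)%E.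
  move=> mf; rewrite (_ : (fun _ => _) = EFin \o (fun t => `|f t| `^ p)) //.
  apply/measurable_EFinP; apply: measurableT_comp (measurable_powR _) _.
  exact: measurableT_comp.
rewrite Lp_normE unlock; apply: gt0_ler_poweR.
- by rewrite invr_ge0 ltW.
- by rewrite in_itv /= leey andbT integral_ge0.
- by rewrite in_itv /= leey andbT integral_ge0.
apply: ge0_le_integral => //.
- by move=> t _; exact: poweR_ge0.
- exact: (mp _ (mr _ muv)).
- exact: (mp _ (measurable_funD (mr _ mu_) (mr _ mv))).
move=> t _; rewrite lee_fin ge0_ler_powR ?nnegrE //; first exact: ltW.
rewrite /= !patchE; case: ifP => _; last by rewrite addr0.
by rewrite normr_id [leRHS]ger0_norm ?addr_ge0 // ler_normD.
Qed.

Lemma Lp_normZ a u : strongly_measurable u ->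
  Lp_norm (a *: u) = (`|a|%:E * Lp_norm u)%E.
Proof.
move=> mu_; rewrite /Lp_norm.
under eq_integral do rewrite normrZ powRM // EFinM.
rewrite ge0_integralZl//.
- rewrite poweRM ?lee_fin ?powR_ge0 ?integral_ge0 //.
  by rewrite poweR_EFin -powRrM mulfV ?gt_eqF // powRr1.
- apply/measurable_EFinP; apply: measurableT_comp (measurable_powR _) _.
  exact: strongly_measurable_norm.
Qed.

Lemma Lp_norm_eq0 u : strongly_measurable u ->
  Lp_norm u = 0%E <-> u = (0 : R -> X) %[ae mu in I].
Proof.
move=> mu_.
have mI : measurable (I : set R) by exact: measurable_itv.
have mf : measurable_fun I (fun t => (`|u t| `^ p)%:E).
  apply/measurable_EFinP; apply: measurableT_comp (measurable_powR _) _.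
  exact: strongly_measurable_norm.
have -> : Lp_norm u = 0%E <-> (\int[mu]_(t in I) `|(`|u t| `^ p)%:E|)%E = 0%E.
  under eq_integral do rewrite gee0_abs ?lee_fin ?powR_ge0 //.
  split; first by apply: poweR_eq0_eq0; exact: integral_ge0.
  by move=> h; rewrite /Lp_norm h poweR0r // invr_eq0 gt_eqF.
rewrite ae_eq_integral_abs //; split; apply: (@filterS _ _ (ae_filter_ringOfSetsType mu)) => t /[apply] /=.
  by move=> [] /powR_eq0_eq0 /normr0_eq0.
by move=> ->; rewrite normr0 powR0 // gt_eqF.
Qed.

Definition LpFun_pred : {pred R -> X} :=
  mem [set u | strongly_measurable u /\ (Lp_norm u < +oo)%E].

Lemma LpFun_submod_closed : submod_closed LpFun_pred.
Proof.
have sm0 : strongly_measurable 0.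
  exists (fun _ _ => 0); split; first by move=> _; exact: simple_fun_cst.
  by move=> t _; exact: cvg_cst.
split; first by rewrite inE; split=> //; rewrite (Lp_norm_eq0 sm0).2 //; exact: aeW.
move=> a u v; rewrite !inE => -[mu_ lu] [mv lv]; split.
  exact: strongly_measurableZD.
have mau : strongly_measurable (a *: u).
  by have := strongly_measurableZD a mu_ sm0; rewrite addr0.
apply: le_lt_trans (Lp_normD mau mv) _; rewrite Lp_normZ //.
by rewrite lte_add_pinfty // lte_mul_pinfty // lee_fin.
Qed.

End BochnerLp.

Section BochnerSpace.
Context (R : realType) (X : normedModType R) (T p : R) (p1 : 1 <= p).

Local Notation mu := (@lebesgue_measure R).
Local Notation I := `]0, T[%classic.

(* The proof of 1 <= p is a parameter, as in LfunType: it is what makes the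
   functions with finite norm a vector space. *)
Record LpFun_of (le1p : 1 <= p) := LpFun
  { LpFun_val :> R -> X ; _ : LpFun_val \in LpFun_pred T p }.
Local Notation Lpfun := (LpFun_of p1).

HB.instance Definition _ := [isSub for @LpFun_val p1].
HB.instance Definition _ := [Choice of Lpfun by <:].
HB.instance Definition _ := GRing.isSubmodClosed.Build _ _ (@LpFun_pred R X T p)
  (@LpFun_submod_closed R X T p p1).
HB.instance Definition _ := [SubChoice_isSubLmodule of Lpfun by <:].

Definition ae0_pred : {pred Lpfun} :=
  mem [set u : Lpfun | (u : R -> X) = (0 : R -> X) %[ae mu in I]].

Lemma ae0_submod_closed : submod_closed ae0_pred.
Proof.
split; first by rewrite inE; exact: aeW.
move=> a u v; rewrite !inE /=.
apply: (@filterS2 _ _ (ae_filter_ringOfSetsType mu)) => t uI vI It.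
rewrite -[LHS]/(a *: u t + v t) uI // vI //.
by rewrite -[RHS]/(0 : X) addr0 scaler0.
Qed.

HB.instance Definition _ := GRing.isSubmodClosed.Build _ _ ae0_pred
  ae0_submod_closed.

Definition Lp := Quotient.quot ae0_pred.
HB.instance Definition _ := GRing.Zmodule.on Lp.
HB.instance Definition _ := EqQuotient.on Lp.

Local Open Scope quotient_scope.

Lemma Lp_eqP (u v : Lpfun) :
  \pi_Lp u = \pi_Lp v <-> (u : R -> X) = v %[ae mu in I].
Proof.
have -> : \pi_Lp u = \pi_Lp v <-> (u - v) \in ae0_pred.
  by rewrite Quotient.idealrBE; split=> [->|/eqP].
rewrite inE; split; apply: (@filterS _ _ (ae_filter_ringOfSetsType mu)) => t uv It.
  have /eqP := uv It; rewrite -[X in X == _]/(u t - v t) -[X in _ == X]/(0 : X).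
  by rewrite subr_eq0 => /eqP.
by rewrite -[LHS]/(u t - v t) uv // subrr.
Qed.

Definition Lp_scale (a : R) (u : Lp) : Lp := \pi_Lp (a *: repr u).

Lemma Lp_pi_scale a (u : Lpfun) : Lp_scale a (\pi u) = \pi_Lp (a *: u).
Proof.
apply/Lp_eqP; have /Lp_eqP := reprK (\pi_Lp u).
apply: (@filterS _ _ (ae_filter_ringOfSetsType mu)) => t uv It.
by rewrite -[LHS]/(a *: repr (\pi_Lp u) t) uv.
Qed.

Lemma Lp_piD (u v : Lpfun) : \pi_Lp u + \pi_Lp v = \pi_Lp (u + v).
Proof. exact/esym/Quotient.pi_add. Qed.

Lemma Lp_scaleA a b u : Lp_scale a (Lp_scale b u) = Lp_scale (a * b) u.
Proof. by elim/quotW: u => u; rewrite (Lp_pi_scale b u) !Lp_pi_scale scalerA. Qed.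

Lemma Lp_scale1 : left_id 1 Lp_scale.
Proof. by elim/quotW=> u; rewrite Lp_pi_scale scale1r. Qed.

Lemma Lp_scaleDr : right_distributive Lp_scale +%R.
Proof.
move=> a; elim/quotW=> u; elim/quotW=> v.
by rewrite Lp_piD [LHS]Lp_pi_scale scalerDr -Lp_piD -!Lp_pi_scale.
Qed.

Lemma Lp_scaleDl u : {morph Lp_scale^~ u : a b / a + b}.
Proof.
elim/quotW: u => u a b.
by rewrite [LHS]Lp_pi_scale scalerDl -Lp_piD -!Lp_pi_scale.
Qed.

HB.instance Definition _ := GRing.Zmodule_isLmodule.Build R Lp
  Lp_scaleA Lp_scale1 Lp_scaleDr Lp_scaleDl.

Definition Lp_fun (u : Lp) : R -> X := repr u.

Definition Lp_normr (u : Lp) : R := fine (Lp_norm T p (Lp_fun u)).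

Lemma LpFun_strongly_measurable (u : Lpfun) : strongly_measurable T u.
Proof. by have := valP u; rewrite inE => -[]. Qed.

Lemma LpFun_norm_fin (u : Lpfun) : Lp_norm T p u \is a fin_num.
Proof.
by have := valP u; rewrite inE => -[_ ?]; rewrite ge0_fin_numE // Lp_norm_ge0.
Qed.

Lemma Lp_normr_pi (u : Lpfun) : Lp_normr (\pi u) = fine (Lp_norm T p u).
Proof.
rewrite /Lp_normr /Lp_fun; congr (fine (_ `^ _)%E).
have mf (v : Lpfun) : measurable_fun I (fun t => (`|v t| `^ p)%:E).
  apply/measurable_EFinP; apply: measurableT_comp (measurable_powR _) _.
  by apply: strongly_measurable_norm; exact: LpFun_strongly_measurable.
apply: ge0_ae_eq_integral.
- exact: measurable_itv.
- exact: mf.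
- exact: mf.
- by move=> t _; rewrite lee_fin powR_ge0.
- by move=> t _; rewrite lee_fin powR_ge0.
have /Lp_eqP := reprK (\pi_Lp u).
by apply: (@filterS _ _ (ae_filter_ringOfSetsType mu)) => t uv It; rewrite uv.
Qed.

Lemma ler_Lp_normD (u v : Lp) : Lp_normr (u + v) <= Lp_normr u + Lp_normr v.
Proof.
have fin := LpFun_norm_fin; elim/quotW: u => u; elim/quotW: v => v.
rewrite Lp_piD !Lp_normr_pi -fineD // fine_le //.
- by rewrite fin_numD !fin.
- exact: (Lp_normD p1 (LpFun_strongly_measurable _) (LpFun_strongly_measurable _)).
Qed.

Lemma Lp_normrZ (a : R) (u : Lp) : Lp_normr (a *: u) = `|a| * Lp_normr u.
Proof.
have fin := LpFun_norm_fin; elim/quotW: u => u.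
rewrite -[_ *: _]/(Lp_scale _ _) Lp_pi_scale !Lp_normr_pi.
by rewrite (Lp_normZ p1 _ (LpFun_strongly_measurable _)) fineM.
Qed.

Lemma Lp_normr_eq0 (u : Lp) : Lp_normr u = 0 -> u = 0.
Proof.
have fin := LpFun_norm_fin.
elim/quotW: u => u; rewrite Lp_normr_pi => /eqP; rewrite fine_eq0 // => /eqP.
move=> /(Lp_norm_eq0 p1 (LpFun_strongly_measurable _)) h.
have -> : \pi_Lp u = \pi_Lp 0 by exact/Lp_eqP.
by have := Lp_piD 0 0; rewrite addr0 -[X in _ = X]add0r => /addIr.
Qed.

HB.instance Definition _ := Lmodule_isNormed.Build R Lp
  ler_Lp_normD Lp_normrZ Lp_normr_eq0.

End BochnerSpace.

Coercion Lp_fun : Lp >-> Funclass.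

(* A partition of ]0, T[ is a duplicate-free sequence of pairs (a_i, b_i), in
   any order, standing for the open intervals ]a_i, b_i[. *)
Definition interval_partition (R : realType) (T : R) (sigma : seq (R * R)) : Prop :=
  [/\ uniq sigma,
      {in sigma, forall s, s.1 < s.2},
      {in sigma &, forall s r, s != r ->
        `]s.1, s.2[%classic `&` `]r.1, r.2[%classic = set0}
    & \bigcup_(s in [set` sigma]) `[s.1, s.2]%classic = `[0, T]%classic].

(* Only the values of x on [0, T] matter, and they matter pointwise. *)
Definition BV_norm (R : realType) (Z : normedModType R) (T q : R) (x : R -> Z)
    : \bar R :=
  (ereal_sup [set (\sum_(s <- sigma) `|x s.2 - x s.1| `^ q)%:E
              | sigma in interval_partition T] `^ q^-1)%E.

(* M^{p,q}(I; X, Z) for an embedding j : X -> Z. Elements of L^p are classes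
   while BV^q depends on pointwise values; an element of the intersection is
   thus a pointwise defined Z-valued function together with the class in
   L^p(I; X) that it represents, unique when j is injective. *)
Record Mpq (R : realType) (X Z : normedModType R) (j : X -> Z) (T p q : R)
    (p1 : 1 <= p) := MkMpq {
  M_Lp : Lp X T p1 ;
  M_BV : R -> Z ;
  M_ae : M_BV = j \o M_Lp %[ae (@lebesgue_measure R) in `]0, T[%classic] ;
  M_BV_fin : (BV_norm T q M_BV < +oo)%E }.

Section Mnorm.
Context (R : realType) (X Z : normedModType R) (j : X -> Z) (T p q : R).
Context (p1 : 1 <= p).

Definition M_norm (x : Mpq j T q p1) : R :=
  `|M_Lp x| + fine (BV_norm T q (M_BV x)).

Definition M_bounded (G : set (Mpq j T q p1)) : Prop :=
  exists C : R, forall x, G x -> M_norm x <= C.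

End Mnorm.

Definition compact_map (R : realType) (X Y : normedModType R) (f : X -> Y) : Prop :=
  forall B : set X, bounded_set B -> precompact (f @` B).

(* The image of G in L^p(I; Y) under the inclusion induced by i : X -> Y. *)
Definition Lp_image (R : realType) (X Y Z : normedModType R) (j : X -> Z)
    (T p q : R) (p1 : 1 <= p) (i : X -> Y) (G : set (Mpq j T q p1)) :
    set (Lp Y T p1) :=
  [set y | exists2 x, G x &
    (y : R -> Y) = i \o M_Lp x %[ae (@lebesgue_measure R) in `]0, T[%classic]].

(* Main.v *)
Require Import Defs.
From mathcomp Require Import all_boot all_order all_algebra.
From mathcomp Require Import all_classical all_reals all_analysis.
From mathcomp Require Import measurable_realfun ring lra.

(** Why the theorem holds.

    An element of a bounded set is close in L^p(I; X2) to a step function on a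
    uniform grid of N cells whose value on each cell is a value u(t_k) of the
    function itself, at a well chosen point of the cell.

    - Choose t_k in the k-th cell where |u(t_k)|_1^p does not exceed the mean of
      |u|_1^p over the cell by more than 1. Then the step function is bounded in
      L^p(I; X1), uniformly in u and in N.
    - In X3 the distance between u(t) and u(t_k) is an increment of u inside
      the k-th cell. Increments inside different cells run over disjoint
      intervals, so the sum of their q-th powers is at most the q-th power of
      the BV^q norm. Hence the increment exceeds a given eta on at most
      (C / eta)^q cells, however large N is, and these cells have small total
      measure when N is large; elsewhere the error is at most eta [step_approximation].
    - Compactness of X1 in X2 and injectivity of X2 into X3 give Ehrling's
      inequality |v|_2 <= e |v|_1 + D |v|_3 [ehrling]: smallness in X3 together
      with boundedness in X1 is smallness in X2. This gives the approximation in
      L^p(I; X2) [Lp_step_estimate].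
    - For fixed N the values u(t_k) stay in a ball of X1, which is precompact in
      X2, so finitely many step functions approximate all of them [step_net].

    The set is thus totally bounded in L^p(I; X2), with nets made of simple
    functions. Instead of the completeness of the whole of L^p, it then suffices
    that a Cauchy sequence of simple functions converges: the limit of simple
    functions is strongly measurable by definition. This, with an ultrafilter
    argument, gives [totally_bounded_simple_precompact].

    Only point values of vector functions and integrals of real functions are
    used, and the argument is the same for p = 1 and p > 1. *)

Set Implicit Arguments.
Unset Strict Implicit.
Unset Printing Implicit Defensive.
Import Order.TTheory GRing.Theory Num.Theory.
Import numFieldNormedType.Exports.
Local Open Scope classical_set_scope.
Local Open Scope ring_scope.

(** * Ehrling's inequality and finite nets *)

(** On the part of the compact image of the unit ball where the middle norm is
    at least [e], the weakest norm is continuous and does not vanish, so it is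
    bounded below; elsewhere the middle norm is already below [e]. *)
Lemma ehrling (R : realType) (X1 X2 X3 : normedModType R)
    (i : {linear X1 -> X2}) (j : {linear X2 -> X3}) :
  injective j -> compact_map i -> continuous j ->
  forall e, 0 < e -> exists2 C, 0 <= C &
    forall v, `|i v| <= e * `|v| + C * `|j (i v)|.
Proof.
move=> jinj ci cj e e0.
suff [C C0 HC] : exists2 C, 0 <= C &
    forall v, `|v| <= 1 -> `|i v| <= e + C * `|j (i v)|.
  exists C => // v; have [->|v0] := eqVneq v 0.
    by rewrite !linear0 !normr0 !mulr0 addr0.
  have nv : 0 < `|v| by rewrite normr_gt0.
  have := HC (`|v|^-1 *: v); rewrite normrZ normfV normr_id mulVf ?gt_eqF//.
  rewrite !linearZ_LR !normrZ normfV normr_id => /(_ (lexx _)).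
  have vV : `|v| != 0 by rewrite gt_eqF.
  rewrite -(ler_pM2l nv) mulVKf// => /le_trans; apply.
  by rewrite mulrDr mulrC (mulrCA C) mulVKf.
have [|K subK [cK clK]] := ci [set v | `|v| <= 1].
  exists 1; split; first exact: num_real.
  by move=> M M1 x /= /le_trans; apply; exact: ltW.
(* The constant is an upper bound of the norm on K over the minimum of |j y| on L. *)
have [M [_ /(_ (M + 1))]] := compact_bounded cK.
rewrite ltrDl => /(_ ltr01) KM.
pose L := K `&` [set y | e <= `|y|].
have cL : compact L.
  apply: compact_closedI => //.
  rewrite (_ : [set _ | _] = (fun y : X2 => `|y|) @^-1` [set r | e <= r])//.
  apply: closed_comp; last exact: closed_ge.
  by move=> y _; exact: norm_continuous.
have M1 : 0 <= M + 1.
  apply: le_trans (normr_ge0 (i 0)) _; apply: KM.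
  by apply: subK; exists 0 => //=; rewrite normr0.
have [L0|/set0P/negP/negPn/eqP L0] := pselect (L !=set0); last first.
  exists 0 => // v v1; rewrite mul0r addr0 leNgt; apply/negP => ev.
  suff : L (i v) by rewrite L0.
  by split; [apply: subK; exists v|exact: ltW].
have cjn : {within L, continuous (fun y => `|j y|)}.
  by apply: continuous_subspaceT => y; apply: cvg_norm; exact: cj.
have [c cL' jc] := compact_EVT_min L0 cL cjn.
have j0 : 0 < `|j c|.
  rewrite normr_gt0; apply/eqP; rewrite -(linear0 j) => /jinj c0.
  by move: cL'; rewrite inE => -[_ /=]; rewrite c0 normr0 leNgt e0.
exists ((M + 1) / `|j c|); first by rewrite divr_ge0.
move=> v v1; have iK : K (i v) by apply: subK; exists v.
have [/ltW iv|iv] := ltP `|i v| e.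
  by apply: le_trans iv _; rewrite lerDl mulr_ge0// divr_ge0.
apply: (@le_trans _ _ (M + 1)); first exact: KM.
rewrite -[leLHS]add0r; apply: lerD; first exact: ltW.
by rewrite mulrAC -mulrA ler_peMr// ler_pdivlMr// mul1r jc// inE; split.
Qed.

Lemma compact_finite_net (R : realType) (X : normedModType R) (K : set X) (e : R) :
  compact K -> 0 < e ->
  exists W : seq X, forall x, K x -> exists2 w, w \in W & `|x - w| < e.
Proof.
rewrite compact_cover => cK e0.
have [||D _ DK] := cK X setT (fun w => [set x | `|x - w| < e]).
- move=> w _; rewrite (_ : [set _ | _] = ball w e); last first.
    by rewrite -ball_normE; apply/seteqP; split => x /=; rewrite distrC.
  exact: ball_open.
- by move=> x Kx; exists x => //=; rewrite subrr normr0.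
exists (finmap.enum_fset D) => x /DK[w /= wD xw]; by exists w.
Qed.

(** * Increments over disjoint intervals *)

Section Variation.
Context (R : realType).
Implicit Types (a T q : R) (ps : seq R).

(** Consecutive pairs of a nondecreasing sequence of points. Repeated points are
    skipped, because the intervals of a partition are nondegenerate. *)
Fixpoint chain a ps : seq (R * R) :=
  if ps is p :: ps' then
    if a < p then (a, p) :: chain p ps' else chain p ps'
  else [::].

Lemma path_le_last a ps : path <=%R a ps -> a <= last a ps.
Proof.
by elim: ps a => //= p ps IH a /andP[ap /IH]; exact: le_trans.
Qed.

Lemma chain_bounds a ps s : path <=%R a ps -> s \in chain a ps ->
  [/\ a <= s.1, s.1 < s.2 & s.2 <= last a ps].
Proof.
elim: ps a => //= p ps IH a /andP[ap pps]; case: ifPn => [ap'|_] sc.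
  move: sc; rewrite inE => /orP[/eqP ->/=|/(IH _ pps)[? ? ?]]; last first.
    by split=> //; exact: le_trans ap _.
  by split=> //; exact: path_le_last.
by have [? ? ?] := IH _ pps sc; split=> //; exact: le_trans ap _.
Qed.

Lemma chain_uniq a ps : path <=%R a ps -> uniq (chain a ps).
Proof.
elim: ps a => //= p ps IH a /andP[ap pps]; case: ifPn => [ap'|_]; last exact: IH.
rewrite cons_uniq IH// andbT; apply/negP => /(chain_bounds pps)[/=].
by rewrite leNgt ap'.
Qed.

Lemma chain_disjoint a ps : path <=%R a ps ->
  {in chain a ps &, forall s r, s != r ->
    `]s.1, s.2[%classic `&` `]r.1, r.2[%classic = set0 :> set R}.
Proof.
elim: ps a => //= p ps IH a /andP[ap pps]; case: ifPn => [ap'|_]; last exact: IH.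
have H r : r \in chain p ps -> `]a, p[%classic `&` `]r.1, r.2[%classic = set0 :> set R.
  move=> /(chain_bounds pps)[pr _ _]; apply/seteqP; split => // t /=.
  rewrite !in_itv/= => -[/andP[_ tp] /andP[rt _]].
  by have := lt_trans (le_lt_trans pr rt) tp; rewrite ltxx.
move=> s r; rewrite !inE => /orP[/eqP->|sc] /orP[/eqP->|rc].
- by rewrite eqxx.
- by move=> _; exact: H.
- by move=> _; rewrite setIC; exact: H.
- exact: (IH _ pps).
Qed.

Lemma chain_cover a ps : path <=%R a ps -> a < last a ps ->
  \bigcup_(s in [set` chain a ps]) `[s.1, s.2]%classic
    = `[a, last a ps]%classic :> set R.
Proof.
move=> pa al; apply/seteqP; split.
  move=> t [s /= /(chain_bounds pa)[as1 _ sl]]; rewrite !in_itv/= => /andP[st ts].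
  by rewrite (le_trans _ st)// (le_trans ts).
elim: ps a pa al => [|p ps IH] a /=; first by rewrite ltxx.
move=> /andP[ap pps] al t; rewrite /= in_itv/= => /andP[at_ tl].
have [tp|pt] := leP t p.
  case: ifPn => [ap'|].
    exists (a, p); first by rewrite /= inE eqxx.
    by rewrite /= in_itv/= at_ tp.
  rewrite -leNgt => pa.
  have /eqP ?: p == t by rewrite eq_le tp (le_trans pa at_).
  subst p; apply: IH => //=; last by rewrite in_itv/= lexx.
  exact: le_lt_trans pa al.
have : p < last p ps by exact: lt_le_trans pt tl.
move=> /(IH _ pps) /(_ t); rewrite /= in_itv/= (ltW pt) tl => /(_ isT)[s sc st].
by case: ifPn => _; exists s; rewrite //= inE sc orbT.
Qed.

Lemma sum_chain (F : R * R -> R) a ps : (forall c, F (c, c) = 0) ->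
  path <=%R a ps ->
  \sum_(s <- chain a ps) F s = \sum_(s <- zip (a :: ps) ps) F s.
Proof.
move=> F0; elim: ps a => [|p ps IH] a /=; first by rewrite !big_nil.
move=> /andP[ap pps]; rewrite big_cons -IH//; case: ifPn => [_|].
  by rewrite big_cons.
rewrite -leNgt => pa; have -> : p = a by apply/eqP; rewrite eq_le pa.
by rewrite F0 add0r.
Qed.

(** The intervals [[a k, b k]] need not cover [[0, T]]: the gaps between them
    complete them to a partition and contribute nonnegative terms. *)
Lemma sum_variation_le (Z : normedModType R) (x : R -> Z) T q (n : nat)
    (a b : nat -> R) : 0 < q -> 0 < T ->
  (forall k, (k < n)%N -> [/\ 0 <= a k, a k <= b k & b k <= T]) ->
  (forall k l, (k < l < n)%N -> b k <= a l) ->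
  ((\sum_(k < n) `|x (b k) - x (a k)| `^ q)%:E <=
   ereal_sup [set (\sum_(s <- sigma) `|x s.2 - x s.1| `^ q)%:E
              | sigma in interval_partition T])%E.
Proof.
move=> q0 T0 abT ba.
pose F (s : R * R) := `|x s.2 - x s.1| `^ q.
have F0 c : F (c, c) = 0 by rewrite /F subrr normr0 powR0// gt_eqF.
(* a_m <= b_m <= a_(m+1) <= ... <= T; the starting point is added by chain. *)
pose pts m l := flatten [seq [:: a k; b k] | k <- iota m l] ++ [:: T].
have ind : forall l m c, (m + l <= n)%N ->
    (forall k, (m <= k < m + l)%N -> c <= a k) -> c <= T ->
    path <=%R c (pts m l) /\
    \sum_(k <- iota m l) F (a k, b k) <=
      \sum_(s <- zip (c :: pts m l) (pts m l)) F s.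
  elim=> [|l IH] m c mln ca cT.
    by rewrite /pts /= !big_nil big_cons big_nil addr0 cT powR_ge0.
  have [am0 abm bmT] : [/\ 0 <= a m, a m <= b m & b m <= T].
    by apply: abT; rewrite (leq_trans _ mln)// addnS ltnS leq_addr.
  have [||//|P S] := IH m.+1 (b m).
  - by rewrite addSn -addnS.
  - move=> k /andP[mk kl]; apply: ba; rewrite mk/=.
    by apply: leq_trans kl _; rewrite addSn -addnS.
  split; first by rewrite /pts /= ca ?abm//= leqnn addnS ltnS leq_addr.
  rewrite /pts /= -/(pts m.+1 l) !big_cons.
  by apply: ler_wpDl; [exact: powR_ge0|rewrite lerD2l].
have [|||P S] := ind n 0%N 0; [by []| |exact: ltW|].
  by move=> k /andP[_ /abT[]].
have lastT : last 0 (pts 0%N n) = T by rewrite /pts last_cat.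
apply: (@le_trans _ _ (\sum_(s <- chain 0 (pts 0%N n)) F s)%:E).
  rewrite lee_fin (sum_chain F0 P); apply: le_trans S.
  by rewrite -(big_mkord xpredT (fun k => F (a k, b k))) /index_iota subn0.
apply: ereal_sup_ubound; exists (chain 0 (pts 0%N n)) => //; split.
- exact: chain_uniq.
- by move=> s /(chain_bounds P)[].
- exact: chain_disjoint.
- by rewrite chain_cover ?lastT.
Qed.

End Variation.

(** * Limits of simple functions in L^p *)

Lemma cvg_powR (R : realType) (p : R) (u : nat -> R) (l : R) : 0 < p ->
  (forall n, 0 <= u n) -> u n @[n --> \oo] --> l ->
  u n `^ p @[n --> \oo] --> l `^ p.
Proof.
move=> p0 u0 ul.
have : 0 <= l.
  by rewrite -(cvg_lim _ ul)//; apply: limr_ge; [exact: cvgP ul|exact: nearW].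
rewrite le_eqVlt => /predU1P[l0|l0]; last first.
  have /derivable1_diffP/differentiable_continuous pc :
      derivable (fun x : R => x `^ p) l 1.
    by apply: derivable_powR; rewrite in_itv/= l0.
  exact: (continuous_cvg _ pc ul).
move: ul; rewrite -{}l0 powR0 ?gt_eqF// => /cvgr0Pnorm_lt ul.
apply/cvgr0Pnorm_lt => e e0; have := ul _ (powR_gt0 p^-1 e0).
apply: filterS => n; rewrite !ger0_norm ?powR_ge0// => une.
rewrite (_ : e = (e `^ p^-1) `^ p); last first.
  by rewrite -powRrM mulVf ?gt_eqF// powRr1// ltW.
by rewrite gt0_ltr_powR// nnegrE// powR_ge0.
Qed.

Section LpConvergence.
Local Open Scope quotient_scope.
Context (R : realType) (X : normedModType R) (T p : R) (p1 : 1 <= p).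

Local Notation mu := (@lebesgue_measure R).
Local Notation I := `]0, T[%classic.
Local Notation Lpfun := (LpFun_of X T p1).
Local Notation toLp := (\pi_(Lp X T p1)).

Let p0 : 0 < p. Proof. exact: lt_le_trans p1. Qed.

Lemma measurable_norm_powR (u : R -> X) : strongly_measurable T u ->
  measurable_fun I (fun t => (`|u t| `^ p)%:E).
Proof.
move=> mu_; apply/measurable_EFinP; apply: measurableT_comp (measurable_powR _) _.
exact: strongly_measurable_norm.
Qed.

Lemma Lp_norm_le (u : R -> X) (c : R) : 0 <= c ->
  (\int[mu]_(t in I) (`|u t| `^ p)%:E <= (c `^ p)%:E)%E ->
  (Lp_norm T p u <= c%:E)%E.
Proof.
move=> c0 uc; have -> : c%:E = ((c `^ p)%:E `^ p^-1)%E.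
  by rewrite poweR_EFin -powRrM mulfV ?gt_eqF // powRr1.
apply: gt0_ler_poweR => //; first by rewrite invr_ge0 ltW.
- rewrite in_itv /= leey andbT; apply: integral_ge0 => t _.
  by rewrite lee_fin powR_ge0.
- by rewrite in_itv /= leey andbT lee_fin powR_ge0.
Qed.

Lemma integral_powR_Lp_norm (u : R -> X) :
  (\int[mu]_(t in I) (`|u t| `^ p)%:E = Lp_norm T p u `^ p)%E.
Proof.
rewrite /Lp_norm -poweRrM mulVf ?gt_eqF // poweRe1//.
by apply: integral_ge0 => t _; rewrite lee_fin powR_ge0.
Qed.

Lemma Lp_norm_lty (u : R -> X) :
  (\int[mu]_(t in I) (`|u t| `^ p)%:E < +oo)%E -> (Lp_norm T p u < +oo)%E.
Proof. exact: poweR_lty. Qed.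

Lemma Lp_norm_ae (u v : R -> X) :
  strongly_measurable T u -> strongly_measurable T v -> u = v %[ae mu in I] ->
  Lp_norm T p u = Lp_norm T p v.
Proof.
move=> mu_ mv uv; rewrite /Lp_norm; congr (_ `^ _)%E.
apply: ge0_ae_eq_integral.
- exact: measurable_itv.
- exact: measurable_norm_powR.
- exact: measurable_norm_powR.
- by move=> t _; rewrite lee_fin powR_ge0.
- by move=> t _; rewrite lee_fin powR_ge0.
by apply: (@filterS _ _ (ae_filter_ringOfSetsType mu)) uv => t + It => ->.
Qed.

Lemma LpFun_norm_lty (u : Lpfun) : (Lp_norm T p u < +oo)%E.
Proof. by have := valP u; rewrite inE => -[]. Qed.

Lemma Lp_normE_pi (u : Lpfun) : `|toLp u| = fine (Lp_norm T p u).
Proof. exact: Lp_normr_pi. Qed.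

Lemma Lp_distE (u v : Lpfun) : `|toLp u - toLp v| = fine (Lp_norm T p (u - v)).
Proof.
rewrite -Lp_normE_pi; congr `|_|; apply/eqP; rewrite subr_eq Lp_piD.
by rewrite subrK.
Qed.

Lemma integral_dist (u v : Lpfun) :
  (\int[mu]_(t in I) (`|u t - v t| `^ p)%:E = (`|toLp u - toLp v| `^ p)%:E)%E.
Proof.
rewrite Lp_distE -fine_poweR -(integral_powR_Lp_norm (u - v : Lpfun)) fineK//.
rewrite integral_powR_Lp_norm fin_num_poweR//; exact: LpFun_norm_fin.
Qed.

Lemma simple_fun_strongly_measurable (s : R -> X) :
  simple_fun s -> strongly_measurable T s.
Proof. by move=> ss; exists (fun=> s); split=> // t _; exact: cvg_cst. Qed.

(** A consequence of Fatou's lemma: only the integrals of late terms matter. *)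
Lemma fatou_le (f : nat -> R -> \bar R) (g : R -> \bar R) (c : \bar R) (n0 : nat) :
  (forall n, measurable_fun I (f n)) -> (forall n t, I t -> 0 <= f n t)%E ->
  (forall t, I t -> f n t @[n --> \oo] --> g t) ->
  (forall n, (n0 <= n)%N -> \int[mu]_(t in I) f n t <= c)%E ->
  (\int[mu]_(t in I) g t <= c)%E.
Proof.
move=> mf f0 fg fc.
have -> : (\int[mu]_(t in I) g t = \int[mu]_(t in I) limn_einf (f^~ t))%E.
  by apply: eq_integral => t; rewrite inE => It; rewrite (cvg_limn_einf_sup (fg t It)).1.
have mI : measurable (I : set R) by exact: measurable_itv.
apply: le_trans (fatou mu mI mf f0) _.
rewrite limn_einf_lim; apply: lime_le; first exact: is_cvg_einfs.
near=> n; apply: (@le_trans _ _ (\int[mu]_(t in I) f (maxn n n0) t)%E).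
  by apply: ereal_inf_lbound; exists (maxn n n0) => //=; exact: leq_maxl.
by apply: fc; exact: leq_maxr.
Unshelve. all: by end_near. Qed.

(** The pointwise limit is strongly measurable because the approximants are
    simple, and Fatou's lemma turns the Cauchy bound into a bound on the distance
    to the limit, which also shows that the limit lies in L^p. *)
Lemma Lp_cvg_of_pointwise (s : nat -> Lpfun) (u : R -> X) (e : nat -> R) :
  (forall n, simple_fun (s n)) ->
  (forall t, I t -> s n t @[n --> \oo] --> u t) ->
  (forall n m, (n <= m)%N -> `|toLp (s m) - toLp (s n)| <= e n) ->
  exists v : Lpfun, forall n, `|toLp v - toLp (s n)| <= e n.
Proof.
move=> ss su se.
have mu_ : strongly_measurable T u by exists (fun n => s n : R -> X).
have ms n : strongly_measurable T (s n) by exact: simple_fun_strongly_measurable.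
have e0 n : 0 <= e n by apply: le_trans (se n n (leqnn n)); exact: normr_ge0.
have mus n : strongly_measurable T (u - s n).
  by have := strongly_measurableZD (-1) (ms n) mu_; rewrite scaleN1r addrC.
have key n : (Lp_norm T p (u - s n)%R <= (e n)%:E)%E.
  apply: Lp_norm_le => //.
  apply: (@fatou_le (fun m t => (`|s m t - s n t| `^ p)%:E) _ _ n).
  - by move=> m; exact: (measurable_norm_powR (LpFun_strongly_measurable (s m - s n))).
  - by move=> m t _; rewrite lee_fin powR_ge0.
  - move=> t It; apply: cvg_EFin; first exact: nearW.
    apply: cvg_powR => //; apply: cvg_norm; apply: cvgB; last exact: cvg_cst.
    exact: su.
  - move=> m nm; rewrite integral_dist lee_fin ge0_ler_powR ?nnegrE//; first exact: ltW.
    exact: se.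
have uLp : u \in LpFun_pred T p.
  rewrite inE; split=> //.
  have -> : u = (u - s 0%N) + s 0%N by rewrite subrK.
  apply: le_lt_trans (Lp_normD p1 (mus _) (ms _)) _.
  apply: lte_add_pinfty; first by apply: le_lt_trans (key 0%N) _; rewrite ltry.
  exact: LpFun_norm_lty.
exists (LpFun p1 uLp) => n.
rewrite Lp_distE -[leRHS]/(fine (e n)%:E) fine_le//.
- exact: (LpFun_norm_fin (LpFun p1 uLp - s n)).
- exact: (key n).
Qed.

End LpConvergence.

Lemma simple_fun_mask (R : realType) (X : normedModType R) (s : R -> X) (N : set R) :
  measurable N -> simple_fun s -> simple_fun (fun t => if t \in N then 0 else s t).
Proof.
move=> mN ss.
have sN : simple_fun (fun t : R => t \in N).
  split; first exact: finite_finset.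
  case; first by rewrite (_ : _ @^-1` _ = N)//; apply/seteqP; split => t /=; [exact: set_mem|exact: mem_set].
  rewrite (_ : _ @^-1` _ = ~` N); first exact: measurableC.
  by apply/seteqP; split => t /=; [move=> + Nt; rewrite mem_set|exact: memNset].
exact: (simple_fun_comp2 (fun (b : bool) x => if b then 0 else x) sN ss).
Qed.

(** * A compactness criterion in L^p *)

Section Completeness.
Local Open Scope quotient_scope.
Context (R : realType) (X : completeNormedModType R) (T p : R) (p1 : 1 <= p).

Local Notation mu := (@lebesgue_measure R).
Local Notation I := `]0, T[%classic.
Local Notation Lpfun := (LpFun_of X T p1).
Local Notation toLp := (\pi_(Lp X T p1)).

Let p0 : 0 < p. Proof. exact: lt_le_trans p1. Qed.

(** The p-th powers of the increments of the sequence, scaled by [2 ^ n], still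
    have a convergent sum of integrals. So their sum is finite almost
    everywhere, and there the increments are O(2 ^ -n). *)
Lemma fast_cauchy_ae_cvg (s : nat -> Lpfun) :
  (forall n, `|toLp (s n.+1) - toLp (s n)| <= 4^-1 ^+ n.+1) ->
  {ae mu, forall t, I t -> cvgn (fun n => s n t)}.
Proof.
move=> sfast.
have mI : measurable (I : set R) by exact: measurable_itv.
pose f n t := ((2 ^+ n * `|s n.+1 t - s n t|) `^ p)%:E.
have fE n t : f n t = (((2 ^+ n) `^ p)%:E * (`|s n.+1 t - s n t| `^ p)%:E)%E.
  by rewrite /f powRM ?exprn_ge0// EFinM.
have f0 n t : I t -> (0 <= f n t)%E by rewrite lee_fin powR_ge0.
have md n : measurable_fun I (fun t => (`|s n.+1 t - s n t| `^ p)%:E).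
  exact: (measurable_norm_powR p (LpFun_strongly_measurable (s n.+1 - s n))).
have mf n : measurable_fun I (f n).
  apply: (eq_measurable_fun (fun t => ((2 ^+ n) `^ p)%:E * (`|s n.+1 t - s n t| `^ p)%:E)%E).
    by move=> t _; rewrite fE.
  exact: measurable_funeM.
have intf n : (\int[mu]_(t in I) f n t <= (1 / (2 ^ n.+1)%:R)%:E)%E.
  under eq_integral do rewrite fE.
  rewrite ge0_integralZl_EFin ?powR_ge0//; last exact: md.
  rewrite integral_dist -EFinM -powRM ?exprn_ge0// lee_fin.
  apply: (@le_trans _ _ ((2 ^+ n * 4^-1 ^+ n.+1) `^ p)).
    rewrite ge0_ler_powR ?nnegrE ?mulr_ge0 ?exprn_ge0 ?invr_ge0//; first exact: ltW.
    by rewrite ler_pM2l ?exprn_gt0.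
  have -> : 2 ^+ n * 4^-1 ^+ n.+1 = 2^-1 ^+ n.+2 :> R.
    have -> : 4^-1 = 2^-1 * 2^-1 :> R by rewrite -invfM -natrM.
    rewrite exprMn mulrA.
    have -> : 2 ^+ n * 2^-1 ^+ n.+1 = 2^-1 :> R.
      by rewrite exprS mulrCA -exprMn mulfV// expr1n mulr1.
    by rewrite -exprS.
  apply: (@le_trans _ _ (2^-1 ^+ n.+2)).
    rewrite ge1r_powR// ?exprn_gt0 ?invr_gt0//= exprn_ile1 ?invr_ge0//.
    by rewrite invf_le1// ler1n.
  rewrite div1r natrX -exprVn [leLHS]exprS.
  by rewrite ler_piMl ?exprn_ge0 ?invr_ge0// invf_le1// ler1n.
have : mu.-integrable I (fun t => \sum_(0 <= n <oo) f n t)%E.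
  apply/integrableP; split; first by apply: ge0_emeasurable_sum => [k x Ix _|k _]; [exact: f0|exact: mf].
  rewrite (_ : integral _ _ _ = (\int[mu]_(t in I) \sum_(0 <= n <oo) f n t)%E); last first.
    apply: eq_integral => t; rewrite inE => It;  rewrite gee0_abs// nneseries_ge0// => k _ _; exact: f0.
  rewrite integral_nneseries//; apply: (@le_lt_trans _ _ 1%E); last exact: ltry.
  apply: le_trans (epsilon_trick0 xpredT ler01).
  apply: lee_nneseries => [n _ _|n _]; last exact: intf.
  by apply: integral_ge0 => t; exact: f0.
move=> intS; have := @integrable_ae _ _ _ mu I mI _ intS.
apply: (@filterS _ _ (ae_filter_ringOfSetsType mu)) => t + It => /(_ It) fint.
set S := (X in X \is a fin_num) in fint.
have S0 : (0 <= S)%E by apply: nneseries_ge0 => k _ _; exact: f0.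
pose M := fine S `^ p^-1.
have dM n : `|s n.+1 t - s n t| <= M * 2^-1 ^+ n.
  rewrite -[leLHS](mulKf (_ : 2 ^+ n != 0)) ?expf_neq0// -exprVn mulrC.
  rewrite ler_pM2r ?exprn_gt0 ?invr_gt0//.
  have -> : 2 ^+ n * `|s n.+1 t - s n t|
      = ((2 ^+ n * `|s n.+1 t - s n t|) `^ p) `^ p^-1.
    by rewrite -powRrM mulfV ?gt_eqF// powRr1// mulr_ge0 ?exprn_ge0.
  rewrite ge0_ler_powR ?nnegrE ?powR_ge0 ?fine_ge0//.
    by rewrite invr_ge0 ltW.
  rewrite -lee_fin fineK// -/(f n t).
  apply: le_trans (nneseries_lim_ge n.+1 _); last by move=> k _ _; exact: f0.
  rewrite big_nat_recr//= leeDr// sume_ge0// => k _; exact: f0.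
suff : cvgn (series (telescope (fun n => s n t))).
  rewrite telescopeK => sc.
  have -> : (fun n => s n t) = (fun=> s 0%N t) \+ (fun n => s n t - s 0%N t).
    by apply/funext => n /=; rewrite addrC subrK.
  by apply: is_cvgD => //; exact: is_cvg_cst.
apply: normed_cvg; apply: (@series_le_cvg _ _ (geometric M 2^-1)) => //=.
- by move=> n; rewrite mulr_ge0 ?powR_ge0 ?exprn_ge0 ?invr_ge0.
- by apply: is_cvg_geometric_series; rewrite ger0_norm ?invr_ge0// invf_lt1// ltr1n.
Qed.

(** Setting the sequence to zero on a measurable null set makes it converge
    everywhere without changing the classes or losing simplicity. *)
Lemma fast_cauchy_cvg (s : nat -> Lpfun) : (forall n, simple_fun (s n)) ->
  (forall n, `|toLp (s n.+1) - toLp (s n)| <= 4^-1 ^+ n.+1) ->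
  exists v : Lpfun, forall n, `|toLp v - toLp (s n)| <= 4^-1 ^+ n.
Proof.
move=> ss sfast; have [N [mN N0 sN]] := fast_cauchy_ae_cvg sfast.
pose s' n t := if t \in N then 0 else s n t.
have ss' n : simple_fun (s' n) by exact: simple_fun_mask.
have s's n : s' n = s n %[ae mu in I].
  exists N; split=> // t /=; apply: contra_notP => Nt It.
  by rewrite /s' memNset.
have s'Lp n : s' n \in LpFun_pred T p.
  rewrite inE; split; first exact: simple_fun_strongly_measurable.
  rewrite (_ : Lp_norm T p (s' n) = Lp_norm T p (s n)); first exact: LpFun_norm_lty.
  apply: Lp_norm_ae; last exact: s's.
    by apply: simple_fun_strongly_measurable; exact: ss'.
  exact: LpFun_strongly_measurable.
pose S n := LpFun p1 (s'Lp n).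
have SE n : toLp (S n) = toLp (s n) by apply/Lp_eqP; exact: s's.
have [|t It||v vS] := @Lp_cvg_of_pointwise R X T p p1 S (fun t => limn (fun n => s' n t)) (fun n => 4^-1 ^+ n).
- exact: ss'.
- suff : cvgn (fun n => s' n t) by [].
  have [tN|tN] := boolP (t \in N).
    by rewrite /s' tN; exact: is_cvg_cst.
  rewrite /s' (negbTE tN); apply: contrapT => ncv.
  by move/negP: tN; apply; rewrite inE; apply: sN => /= /(_ It).
- move=> n m nm; rewrite !SE.
  (* 4^-(k+1) <= 4^-k - 4^-(k+1): the bounds on the increments telescope. *)
  apply: (@le_trans _ _ (4^-1 ^+ n - 4^-1 ^+ m)); last first.
    by rewrite gerBl exprn_ge0 ?invr_ge0.
  rewrite -(subnK nm); elim: (m - n)%N => [|k IH].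
    by rewrite add0n !subrr normr0.
  rewrite addSn; apply: le_trans (ler_distD (toLp (s (k + n)%N)) _ _) _.
  apply: le_trans (lerD (sfast _) IH) _.
  rewrite exprS; set a := _ ^+ (k + n); set b := _ ^+ n.
  have : 0 <= a by rewrite exprn_ge0 ?invr_ge0.
  lra.
by exists v => n; rewrite -SE.
Qed.

(** An ultrafilter on the closure contains balls of any radius centred at simple
    functions. Centres for radii decreasing fast enough form a Cauchy sequence,
    whose limit is the limit of the ultrafilter. *)
Lemma totally_bounded_simple_precompact (G : set (Lp X T p1)) :
  (forall e, 0 < e -> exists W : seq Lpfun, (forall s, s \in W -> simple_fun s) /\
     forall y, G y -> exists2 s, s \in W & `|y - toLp s| <= e) ->
  precompact G.
Proof.
move=> tb; rewrite precompactE compact_ultra => F UF FG.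
have net e : 0 < e -> exists s : Lpfun,
    simple_fun s /\ F [set z | `|z - toLp s| <= e].
  move=> e0; have e2 : 0 < e / 2 by rewrite divr_gt0.
  have [W [sW GW]] := tb _ e2.
  apply: contrapT => /forallNP nF.
  have FW : F [set z | forall s, s \in W -> ~ (`|z - toLp s| <= e)].
    elim: W sW {GW} => [|s W IH] sW; first by apply: filterS filterT => z _ s.
    have FWs : F (~` [set z | `|z - toLp s| <= e]).
      have [Fs|//] := in_ultra_setVsetC [set z | `|z - toLp s| <= e] UF.
      by exfalso; apply: (nF s); split=> //; apply: sW; rewrite inE eqxx.
    have sW' r : r \in W -> simple_fun r.
      by move=> rW; apply: sW; rewrite inE rW orbT.
    apply: filterS (filterI FWs (IH sW')) => z [zs zW] r.
    by rewrite inE => /predU1P[->|/zW].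
  have [z [Gz Wz]] := filter_ex (filterI FG FW).
  have [y [Gy yz]] := Gz (ball z (e / 2)) (nbhsx_ballx z _ e2).
  have [s sinW ys] := GW _ Gy.
  apply: (Wz s sinW); apply: le_trans (ler_distD y _ _) _.
  rewrite [leRHS]splitr; apply: lerD; last exact: ys.
  by apply: ltW; move: yz; rewrite -ball_normE.
have q0 n : 0 < 4^-1 ^+ n.+1 / 2 :> R by rewrite divr_gt0// exprn_gt0// invr_gt0.
have [s Hs] := choice (fun n => net _ (q0 n)).
have ss n : simple_fun (s n) by case: (Hs n).
have Fs n : F [set z | `|z - toLp (s n)| <= 4^-1 ^+ n.+1 / 2] by case: (Hs n).
have sfast n : `|toLp (s n.+1) - toLp (s n)| <= 4^-1 ^+ n.+1.
  have [z [/= z1 z2]] := filter_ex (filterI (Fs n.+1) (Fs n)).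
  apply: le_trans (ler_distD z _ _) _; rewrite [leRHS]splitr; apply: lerD; last exact: z2.
  rewrite distrC; apply: le_trans z1 _.
  by rewrite ler_pM2r ?invr_gt0// [leLHS]exprS ler_piMl ?exprn_ge0 ?invr_ge0// invf_le1// ler1n.
have [v vs] := fast_cauchy_cvg ss sfast.
have Fv : F --> toLp v.
  apply/fcvg_ballP => e e0.
  have [n ne] : exists n, 4^-1 ^+ n < e / 2.
    have /cvgr0Pnorm_lt/(_ (e / 2)) : (4^-1 ^+ n : R) @[n --> \oo] --> 0.
      by apply: cvg_expr; rewrite ger0_norm ?invr_ge0// invf_lt1// ltr1n.
    rewrite divr_gt0// => /(_ isT) [n _ /(_ n (leqnn n))].
    by exists n; rewrite -(ger0_norm (exprn_ge0 _ _)) ?invr_ge0.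
  apply: filterS (Fs n) => z /= zs; rewrite -ball_normE /=.
  apply: le_lt_trans (ler_distD (toLp (s n)) _ _) _; rewrite [ltRHS]splitr.
  apply: ltr_leD; first exact: le_lt_trans (vs n) ne.
  rewrite distrC; apply: le_trans zs _; apply/ltW; apply: le_lt_trans ne.
  by rewrite exprS -mulrA mulrCA ler_piMr ?exprn_ge0 ?invr_ge0//; lra.
exists (toLp v); split=> //.
rewrite /= (closure_id (closure G)).1; last exact: closed_closure.
rewrite closureEcluster; apply: (cvg_cluster (F := F)).
  by move=> A GA; exact: filterS FG.
by rewrite ultra_cvg_clusterE.
Qed.

End Completeness.

(** * The uniform grid *)

Section Cells.
Context (R : realType) (T : R) (N : nat) (T0 : 0 < T) (N0 : (0 < N)%N).

Local Notation mu := (@lebesgue_measure R).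
Local Notation I := `]0, T[%classic.
Local Notation h := (T / N%:R).

(** Points outside the open interval are sent to the extra index [N], so that
    [cell] takes finitely many values on the whole line and the cells with index
    below [N] partition [I]. *)
Definition cell (t : R) : nat :=
  if t \in `]0, T[ then Num.truncn (t / h) else N.

Let h0 : 0 < h. Proof. by rewrite divr_gt0// ltr0n. Qed.

Lemma cell_step_gt0 : 0 < h. Proof. exact: h0. Qed.

Let hN : h * N%:R = T. Proof. by rewrite divfK// pnatr_eq0 -lt0n. Qed.

Lemma cell_itv t : I t -> (cell t < N)%N /\ (cell t)%:R * h <= t < (cell t).+1%:R * h.
Proof.
move=> It; have /andP[t0 tT] : 0 < t < T by move: It; rewrite /= in_itv.
have th0 : 0 <= t / h by rewrite divr_ge0 ?(ltW t0) ?(ltW h0).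
have /andP[ct tc] := truncn_itv th0.
rewrite /cell It; split; last by rewrite -ler_pdivlMr// ct -ltr_pdivrMr.
rewrite -(ltr_nat R); apply: le_lt_trans ct _.
by rewrite ltr_pdivrMr// mulrC hN.
Qed.

Lemma cell_eq t k : I t -> k%:R * h <= t < k.+1%:R * h -> cell t = k.
Proof.
move=> It kt; rewrite /cell It; apply: truncn_def.
by rewrite ler_pdivlMr// ltr_pdivrMr.
Qed.

Lemma cell_lt t : (cell t < N)%N -> I t.
Proof. by rewrite /cell /=; case: ifP => //; rewrite ltnn. Qed.

Lemma preimage_cell k : (k < N)%N ->
  cell @^-1` [set k] = I `&` `[k%:R * h, k.+1%:R * h[%classic.
Proof.
move=> kN; apply/seteqP; split=> t /=.
  move=> ctk; have It : I t by apply: cell_lt; rewrite ctk.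
  by have [_] := cell_itv It; rewrite ctk in_itv.
by move=> [It]; rewrite in_itv => /(cell_eq It).
Qed.

Lemma simple_fun_cell : simple_fun cell.
Proof.
split.
  apply: (@sub_finite_set _ _ `I_N.+1); last exact: finite_II.
  move=> _ [t _ <-] /=; rewrite /cell; case: ifP => [It|_]; last exact: ltnSn.
  by have [] := cell_itv It; rewrite /cell It => /ltnW.
move=> k; have [kN|Nk] := ltnP k N.
  by rewrite preimage_cell//; apply: measurableI; exact: measurable_itv.
have [<-|Nk'] := eqVneq N k.
  rewrite (_ : _ @^-1` _ = ~` I); first by apply: measurableC; exact: measurable_itv.
  apply/seteqP; split=> t /=.
    by move=> ct It; have [] := cell_itv It; rewrite ct ltnn.
  by move=> /negP/negbTE It; rewrite /cell It.
rewrite (_ : _ @^-1` _ = set0)//; apply/seteqP; split=> t //= ctk.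
move: Nk Nk'; rewrite -ctk /cell; case: ifP => [It|_]; last by rewrite eqxx.
by have [] := cell_itv It; rewrite /cell It ltnNge => /negP.
Qed.

Lemma measurable_cell k : measurable (cell @^-1` [set k]).
Proof. exact: simple_fun_cell.2. Qed.

Lemma measure_cell k : (k < N)%N -> mu (cell @^-1` [set k]) = h%:E.
Proof.
move=> kN; rewrite preimage_cell//.
have kT : k.+1%:R * h <= T by rewrite -[leRHS]hN mulrC ler_pM2l// ler_nat.
have kh : k.+1%:R * h - k%:R * h = h by rewrite -mulrBl -natrB// subSnn mul1r.
have khlt : k%:R * h < k.+1%:R * h by rewrite ltr_pM2r// ltr_nat.
rewrite -[in RHS]kh; case: (posnP k) => [k0|k0].
  rewrite (_ : _ `&` _ = `]0, k.+1%:R * h[%classic).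
    by rewrite lebesgue_measure_itv/= lte_fin k0 mul0r in khlt *; rewrite khlt EFinB.
  apply/seteqP; split=> t /=; rewrite !in_itv/= k0 mul0r.
    by move=> [/andP[-> _] /andP[_ ->]].
  by move=> /andP[t0 th]; rewrite t0 th (ltW t0)/=; split=> //; apply: lt_le_trans th _; rewrite -k0.
rewrite (_ : _ `&` _ = `[k%:R * h, k.+1%:R * h[%classic).
  by rewrite lebesgue_measure_itv/= lte_fin khlt EFinB.
apply/seteqP; split=> t /=; rewrite !in_itv/=; first by move=> [].
move=> /andP[t0 th]; rewrite t0 th; split=> //; apply/andP; split.
  by apply: lt_le_trans t0; rewrite mulr_gt0// ltr0n.
exact: lt_le_trans th kT.
Qed.

Lemma integral_cells (f : R -> \bar R) : measurable_fun I f ->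
  (forall t, I t -> 0 <= f t)%E ->
  (\int[mu]_(t in I) f t =
   \sum_(k < N) \int[mu]_(t in cell @^-1` [set nat_of_ord k]) f t)%E.
Proof.
have IE : I = \big[setU/set0]_(k <- enum 'I_N) (cell @^-1` [set nat_of_ord k]).
  rewrite -bigcup_seq; apply/seteqP; split=> t.
    move=> It; have [ctN _] := cell_itv It.
    by exists (Ordinal ctN) => //=; rewrite mem_enum.
  by move=> [k _ /= ctk]; apply: cell_lt; rewrite ctk.
move=> mf f0; rewrite [in LHS]IE ge0_integral_bigsetU.
- by rewrite big_enum.
- by move=> k; exact: measurable_cell.
- exact: enum_uniq.
- by move=> k l _ _ [t [/= -> /ord_inj]].
- by rewrite -IE.
- by rewrite -IE.
Qed.

Lemma integral_step (g : nat -> R) : (forall k, 0 <= g k) ->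
  (\int[mu]_(t in I) (g (cell t))%:E)%E = (h * \sum_(k < N) g k)%:E.
Proof.
move=> g0; rewrite integral_cells; last 2 first.
- apply/measurable_EFinP; apply: (@measurable_funS _ _ _ _ setT) => //.
  apply: simple_fun_measurable.
  exact: (simple_fun_comp2 (fun k _ => g k) simple_fun_cell (simple_fun_cst R tt)).
- by move=> t _; rewrite lee_fin.
rewrite mulr_sumr -sumEFin; apply: eq_bigr => k _.
rewrite (_ : integral _ _ _ = (\int[mu]_(t in cell @^-1` [set nat_of_ord k]) (cst (g k)%:E) t)%E).
  rewrite integral_cst; last exact: measurable_cell.
  by rewrite [X in (_ * X)%E](measure_cell (ltn_ord k)) -EFinM mulrC.
by apply: eq_integral => t; rewrite inE /= => ->.
Qed.

(** A function cannot exceed its mean on a cell by 1 almost everywhere. The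
    margin [h] lets the strict inequality survive integration. *)
Lemma cell_sample (f : R -> R) (P : R -> Prop) k : (k < N)%N ->
  measurable_fun I (EFin \o f) -> (forall t, 0 <= f t) ->
  (\int[mu]_(t in I) (f t)%:E < +oo)%E ->
  {ae mu, forall t, I t -> P t} ->
  exists t, [/\ cell t = k, P t &
    ((h * f t)%:E <= \int[mu]_(t in cell @^-1` [set k]) (f t)%:E + h%:E)%E].
Proof.
move=> kN mf f0 fi aeP; set A := cell @^-1` [set k].
have AI : A `<=` I by move=> t /= ctk; apply: cell_lt; rewrite ctk.
have mA : measurable A by exact: measurable_cell.
have mI : measurable (I : set R) by exact: measurable_itv.
have mfA : measurable_fun A (EFin \o f) by exact: measurable_funS mf.
have : (\int[mu]_(t in A) (f t)%:E \is a fin_num)%E.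
  rewrite ge0_fin_numE; last by apply: integral_ge0 => t _; rewrite lee_fin.
  apply: le_lt_trans fi; apply: ge0_subset_integral => //.
  by move=> t _; rewrite lee_fin.
move=> /fineK; set r := fine _ => rE; rewrite -rE -EFinD.
apply: contrapT => /forallNP nt.
have : (\int[mu]_(t in A) (cst (r / h + 1)%:E) t <= \int[mu]_(t in A) (f t)%:E)%E.
  apply: ae_ge0_le_integral => //.
  - move=> t _; rewrite lee_fin addr_ge0// divr_ge0 ?(ltW h0)//.
    by apply: fine_ge0; apply: integral_ge0 => ? _; rewrite lee_fin.
  - by move=> t _; rewrite lee_fin.
  apply: (@filterS _ _ (ae_filter_ringOfSetsType mu)) aeP => t Pt At.
  rewrite lee_fin leNgt; apply/negP => ft; apply: (nt t); split=> //.
    by apply: Pt; exact: AI.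
  rewrite lee_fin; apply: (@le_trans _ _ (h * (r / h + 1))).
    by rewrite ler_pM2l// ltW.
  by rewrite mulrDr mulr1 mulrC divfK// gt_eqF.
rewrite integral_cst// [X in (_ * X)%E](measure_cell kN) -rE -EFinM lee_fin mulrDl mul1r divfK ?gt_eqF//.
by rewrite gerDl leNgt h0.
Qed.

End Cells.

(** * Sampling a function of bounded variation *)

Section StepApproximation.
Context (R : realType) (X Z : normedModType R) (T p q C : R) (N : nat).
Context (q1 : 1 <= q) (T0 : 0 < T) (C0 : 0 <= C) (N0 : (0 < N)%N).
Context (j : X -> Z) (u : R -> X) (x : R -> Z).

Local Notation mu := (@lebesgue_measure R).
Local Notation I := `]0, T[%classic.
Local Notation h := (T / N%:R).
Local Notation cell := (cell T N).

Context (mu_ : strongly_measurable T u).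
Context (xu : x = j \o u %[ae mu in I]).
Context (uC : (\int[mu]_(t in I) (`|u t| `^ p)%:E <= (C `^ p)%:E)%E).
Context (xC : (ereal_sup [set (\sum_(s <- sigma) `|x s.2 - x s.1| `^ q)%:E
              | sigma in interval_partition T] <= (C `^ q)%:E)%E).

Let h0 : 0 < h. Proof. exact: cell_step_gt0. Qed.
Let q0 : 0 < q. Proof. exact: lt_le_trans q1. Qed.
Let hN : h * N%:R = T. Proof. by rewrite divfK// pnatr_eq0 -lt0n. Qed.

(** Points of different cells are ordered like the cells, so the intervals
    between [s k] and [r k] are disjoint. *)
Lemma cell_oscillation (s r : nat -> R) :
  (forall k, (k < N)%N -> cell (s k) = k /\ cell (r k) = k) ->
  \sum_(k < N) `|x (r k) - x (s k)| `^ q <= C `^ q.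
Proof.
move=> srk; rewrite -lee_fin; apply: le_trans xC.
pose a k := Num.min (s k) (r k); pose b k := Num.max (s k) (r k).
have -> : \sum_(k < N) `|x (r k) - x (s k)| `^ q = \sum_(k < N) `|x (b k) - x (a k)| `^ q.
  apply: eq_bigr => k _; rewrite /a /b; case: (leP (s k) (r k)) => // _.
  by rewrite distrC.
have bnd k : (k < N)%N -> [/\ 0 <= a k, a k <= b k, b k <= T,
    k%:R * h <= a k & b k <= k.+1%:R * h].
  move=> kN; have [sk rk] := srk k kN.
  have Is : I (s k) by apply: (@cell_lt _ _ N); rewrite sk.
  have Ir : I (r k) by apply: (@cell_lt _ _ N); rewrite rk.
  have [_ /andP[s1 s2]] := cell_itv T0 N0 Is.
  have [_ /andP[r1 r2]] := cell_itv T0 N0 Ir.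
  rewrite sk in s1 s2; rewrite rk in r1 r2.
  move: Is Ir; rewrite /= !in_itv/= => /andP[/ltW s3 /ltW s4] /andP[/ltW r3 /ltW r4].
  rewrite /a /b; case: (leP (s k) (r k)) => sr; split=> //; exact: ltW.
apply: sum_variation_le => // [k /bnd[]//|k l /andP[kl lN]].
have [_ _ _ _ bk] := bnd k (ltn_trans kl lN); have [_ _ _ al _] := bnd l lN.
apply: le_trans bk _; apply: le_trans al.
by rewrite ler_pM2r// ler_nat.
Qed.

(** [v k] is the value of [u] at a sample point [tau k] of the k-th cell, and
    [K] selects the cells in which [x] moves away from [x (tau k)] by more than
    [eta]. As their number is bounded independently of [N], their total measure
    tends to 0 as [N] grows. *)
Lemma step_approximation : exists v : nat -> X,
  [/\ forall k, (k < N)%N -> `|v k| `^ p <= C `^ p / h + 1,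
      h * \sum_(k < N) `|v k| `^ p <= C `^ p + T &
      forall eta, 0 < eta -> exists K : pred nat,
        (\sum_(k < N) K k)%:R * eta `^ q <= C `^ q /\
        {ae mu, forall t, I t ->
           `|j (u t) - j (v (cell t))| <= eta + C * (K (cell t))%:R}].
Proof.
have muP : measurable_fun I (fun t => (`|u t| `^ p)%:E).
  exact: measurable_norm_powR.
have int_fin : (\int[mu]_(t in I) (`|u t| `^ p)%:E < +oo)%E.
  exact: le_lt_trans uC (ltry _).
have /choice[tau Htau] : forall k, exists t, (k < N)%N -> [/\ cell t = k,
    x t = j (u t) & ((h * `|u t| `^ p)%:E <=
       \int[mu]_(t in cell @^-1` [set k]) (`|u t| `^ p)%:E + h%:E)%E].
  move=> k; case: (ltnP k N) => [kN|]; last by exists 0.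
  have [|t [? ? ?]] := cell_sample (f := fun t => `|u t| `^ p)
      (P := fun t => x t = j (u t)) T0 N0 kN muP _ int_fin xu.
    by move=> t; exact: powR_ge0.
  by exists t.
have tau_cell k : (k < N)%N -> cell (tau k) = k by move=> /Htau[].
exists (u \o tau); split.
- move=> k kN; have [_ _] := Htau k kN.
  move=> H; rewrite -(ler_pM2l h0) mulrDr mulr1.
  rewrite [X in _ <= X + _]mulrC divfK ?gt_eqF//.
  rewrite -lee_fin; apply: le_trans H _.
  rewrite EFinD leeD2r//; apply: le_trans uC.
  apply: ge0_subset_integral => //.
  - exact: measurable_cell.
  - by move=> t /= ctk; apply: (@cell_lt _ _ N); rewrite ctk.
- rewrite -lee_fin mulr_sumr -sumEFin.
  apply: (@le_trans _ _ (\sum_(k < N)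
     (\int[mu]_(t in cell @^-1` [set nat_of_ord k]) (`|u t| `^ p)%:E + h%:E))%E).
    by apply: lee_sum => k _; have [] := Htau k (ltn_ord k).
  rewrite big_split/= -integral_cells// EFinD; apply: leeD => //.
  by rewrite sumEFin sumr_const card_ord -[_ *+ N]mulr_natr hN.
move=> eta eta0.
pose K k := `[< exists t, cell t = k /\ eta < `|x t - x (tau k)| >].
exists K; split.
  have /choice[r Hr] : forall k, exists t, (k < N)%N -> cell t = k /\
      (K k -> eta < `|x t - x (tau k)|).
    move=> k; have [/asboolP[t [tk xt]]|nK] := boolP (K k); first by exists t.
    by exists (tau k) => /tau_cell.
  apply: le_trans (cell_oscillation (s := tau) (r := r) _); last first.
    by move=> k kN; split; [exact: tau_cell|case: (Hr k kN)].
  rewrite natr_sum mulr_suml; apply: ler_sum => k _.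
  have [_] := Hr k (ltn_ord k); case: (K k) => [/(_ isT) /ltW xr|_].
    rewrite mul1r ge0_ler_powR ?nnegrE//; exact: ltW.
  by rewrite mul0r powR_ge0.
(* A single oscillation is bounded by the whole sum, taking r = tau elsewhere. *)
have osc t : I t -> `|x t - x (tau (cell t))| <= C.
  move=> It; have [ctN _] := cell_itv T0 N0 It.
  have := cell_oscillation (s := tau) (r := fun k => if k == cell t then t else tau k).
  rewrite (bigD1 (Ordinal ctN))//= eqxx => H.
  rewrite leNgt; apply/negP => Cx.
  have : C `^ q < `|x t - x (tau (cell t))| `^ q by rewrite gt0_ltr_powR ?nnegrE.
  rewrite ltNge => /negP; apply; apply: le_trans (H _).
    by rewrite lerDl sumr_ge0// => k _; exact: powR_ge0.
  move=> k kN; split; first exact: tau_cell.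
  by case: eqP => [->//|_]; exact: tau_cell.
apply: (@filterS _ _ (ae_filter_ringOfSetsType mu)) xu => t xut It.
have [ctN _] := cell_itv T0 N0 It; have [_ xtau _] := Htau _ ctN.
rewrite -[j (u t)](xut It) /= -xtau.
have [Kt|nK] := boolP (K (cell t)).
  by rewrite mulr1; apply: le_trans (osc _ It) _; rewrite lerDr ltW.
rewrite mulr0 addr0 leNgt; apply/negP => et; move/asboolP: nK; apply.
by exists t.
Qed.

End StepApproximation.

(** * Finite families of step functions *)

Section StepNet.
Local Open Scope quotient_scope.
Context (R : realType) (X : normedModType R) (T p : R) (p1 : 1 <= p) (N : nat).
Context (T0 : 0 < T) (N0 : (0 < N)%N).

Local Notation mu := (@lebesgue_measure R).
Local Notation I := `]0, T[%classic.
Local Notation Lpfun := (LpFun_of X T p1).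

Lemma simple_fun_step (g : nat -> X) : simple_fun (g \o cell T N).
Proof.
exact: (simple_fun_comp2 (fun k _ => g k) (simple_fun_cell T0 N0) (simple_fun_cst R tt)).
Qed.

Lemma step_LpFun (g : nat -> X) : g \o cell T N \in LpFun_pred T p.
Proof.
rewrite inE; split; first exact/simple_fun_strongly_measurable/simple_fun_step.
apply: Lp_norm_lty; rewrite (integral_step T0 N0 (g := fun k => `|g k| `^ p)).
  exact: ltry.
by move=> k; exact: powR_ge0.
Qed.

(** The step functions with values in [W] form a finite family, and a choice of
    an element of [W] on each cell is one of them. *)
Lemma step_net (W : seq X) : exists F : seq Lpfun,
  (forall s, s \in F -> simple_fun s) /\
  forall P : nat -> X -> Prop,
    (forall k, (k < N)%N -> exists2 w, w \in W & P k w) ->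
    exists2 s, s \in F & forall t, I t -> P (cell T N t) (s t).
Proof.
pose g (f : {ffun 'I_N -> 'I_(size W)}) k :=
  if insub k is Some k' then W`_(f k') else 0.
exists [seq LpFun p1 (step_LpFun (g f)) | f <- enum {ffun 'I_N -> 'I_(size W)}].
split=> [s /mapP[f _ ->]|P PW]; first exact: simple_fun_step.
have /choice[f Hf] : forall k : 'I_N, exists i : 'I_(size W), P k W`_i.
  move=> k; have [w wW Pw] := PW k (ltn_ord k).
  have wi : (index w W < size W)%N by rewrite index_mem.
  by exists (Ordinal wi); rewrite /= nth_index.
exists (LpFun p1 (step_LpFun (g [ffun k => f k]))).
  by apply: map_f; rewrite mem_enum.
move=> t It; have [ctN _] := cell_itv T0 N0 It.
by rewrite /= /g insubT /= ffunE; exact: (Hf (Ordinal ctN)).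
Qed.

End StepNet.

(** * Bounds given by the norm of M^{p,q} *)

Section BoundedMpq.
Context (R : realType) (X Z : normedModType R) (j : X -> Z) (T p q C : R).
Context (p1 : 1 <= p) (q1 : 1 <= q) (T0 : 0 < T) (x : Mpq j T q p1).

Local Notation mu := (@lebesgue_measure R).
Local Notation I := `]0, T[%classic.

Context (xC : M_norm x <= C).

Let q0 : 0 < q. Proof. exact: lt_le_trans q1. Qed.
Let p0 : 0 < p. Proof. exact: lt_le_trans p1. Qed.

Lemma M_norm_Lp : (\int[mu]_(t in I) (`|M_Lp x t| `^ p)%:E <= (C `^ p)%:E)%E.
Proof.
have uC : `|M_Lp x| <= C.
  by apply: le_trans xC; rewrite lerDl fine_ge0// poweR_ge0.
rewrite integral_powR_Lp_norm// -(fineK (LpFun_norm_fin (repr (M_Lp x)))).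
rewrite poweR_EFin lee_fin ge0_ler_powR ?nnegrE; [|exact: ltW| | |exact: uC] => //.
- exact: (normr_ge0 (M_Lp x)).
- exact: le_trans (normr_ge0 _) uC.
Qed.

Lemma M_norm_BV : (ereal_sup [set
  (\sum_(s <- sigma) `|M_BV x s.2 - M_BV x s.1| `^ q)%:E
     | sigma in interval_partition T] <= (C `^ q)%:E)%E.
Proof.
set S := ereal_sup _.
have S0 : (0 <= S)%E.
  have := @sum_variation_le R Z (M_BV x) T q 0 (fun=> 0) (fun=> 0) q0 T0.
  by rewrite big_ord0; apply=> [k|k l /andP[_]]; rewrite ltn0.
have BVE : S = (BV_norm T q (M_BV x) `^ q)%E.
  by rewrite /BV_norm -/S -poweRrM mulVf ?gt_eqF// poweRe1.
have BV0 : (0 <= BV_norm T q (M_BV x))%E by exact: poweR_ge0.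
have BVC : fine (BV_norm T q (M_BV x)) <= C.
  by apply: le_trans xC; rewrite lerDr normr_ge0.
rewrite BVE -(fineK (_ : BV_norm T q (M_BV x) \is a fin_num)); last first.
  by rewrite ge0_fin_numE// (M_BV_fin x).
rewrite poweR_EFin lee_fin ge0_ler_powR ?nnegrE ?fine_ge0//; first exact: ltW.
by apply: le_trans BVC; exact: fine_ge0.
Qed.

End BoundedMpq.

(** * Total boundedness *)

Lemma powR_add_le (R : realType) (p a b : R) : 0 <= p -> 0 <= a -> 0 <= b ->
  (a + b) `^ p <= 2 `^ p * (a `^ p + b `^ p).
Proof.
move=> p0; wlog ab : a b / a <= b.
  move=> H a0 b0; have [ab|/ltW ba] := leP a b; first exact: H.
  by rewrite addrC [in leRHS]addrC; exact: H.
move=> a0 b0; apply: (@le_trans _ _ ((2 * b) `^ p)).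
  by rewrite ge0_ler_powR ?nnegrE ?addr_ge0 ?mulr_ge0//; lra.
by rewrite powRM// ler_pM2l ?powR_gt0// lerDr powR_ge0.
Qed.

Lemma powR_add4_le (R : realType) (p a b c d : R) :
  0 <= p -> 0 <= a -> 0 <= b -> 0 <= c -> 0 <= d ->
  (a + b + (c + d)) `^ p <= 4 `^ p * (a `^ p + b `^ p + (c `^ p + d `^ p)).
Proof.
move=> p0 a0 b0 c0 d0.
apply: le_trans (powR_add_le p0 (addr_ge0 a0 b0) (addr_ge0 c0 d0)) _.
have -> : 4 = 2 * 2 :> R by rewrite -natrM.
rewrite powRM// -mulrA ler_pM2l ?powR_gt0// mulrDr.
by apply: lerD; exact: powR_add_le.
Qed.

(** All terms but the first are constant on cells, so that only one integral is
    not a finite sum. The constant [4 ^ p] comes from a sum of four terms. *)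
Lemma Lp_step_estimate (R : realType) (X Y : normedModType R) (T p : R) (N : nat)
    (u : R -> X) (y : R -> Y) (s : R -> Y) (v : nat -> X) (K : pred nat)
    (e th B r1 r2 : R) :
  1 <= p -> 0 < T -> (0 < N)%N -> 0 <= e -> 0 <= th -> 0 <= B ->
  strongly_measurable T u -> strongly_measurable T y -> strongly_measurable T s ->
  (\int[@lebesgue_measure R]_(t in `]0%R, T[) (`|u t| `^ p)%:E <= r1%:E)%E ->
  T / N%:R * \sum_(k < N) `|v k| `^ p <= r2 ->
  {ae @lebesgue_measure R, forall t, `]0, T[%classic t -> `|y t - s t| <=
     e * `|u t| + e * `|v (cell T N t)| + (th + B * (K (cell T N t))%:R)} ->
  (\int[@lebesgue_measure R]_(t in `]0%R, T[) (`|y t - s t| `^ p)%:E <=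
   (4 `^ p * (e `^ p * r1 + e `^ p * r2 +
      (T * th `^ p + B `^ p * (T / N%:R * (\sum_(k < N) K k)%:R))))%:E)%E.
Proof.
move=> p1 T0 N0 e0 th0 B0 su sy ss ur vr ys.
have p0 : 0 < p by exact: lt_le_trans p1.
have h0 : 0 < T / N%:R by exact: cell_step_gt0.
have mI : measurable (`]0, T[%classic : set R) by exact: measurable_itv.
pose g k := 4 `^ p * (e `^ p * `|v k| `^ p + (th `^ p + B `^ p * (K k)%:R)).
have g0 k : 0 <= g k.
  by rewrite mulr_ge0 ?powR_ge0// !addr_ge0 ?mulr_ge0 ?powR_ge0.
have mgc : measurable_fun `]0, T[%classic (fun t => (g (cell T N t))%:E).
  apply/measurable_EFinP; apply: (@measurable_funS _ _ _ _ setT) => //.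
  apply: simple_fun_measurable.
  exact: (simple_fun_comp2 (fun k _ => g k) (simple_fun_cell T0 N0) (simple_fun_cst R tt)).
have mup := measurable_norm_powR p su.
have mys : strongly_measurable T (y - s).
  by have := strongly_measurableZD (-1) ss sy; rewrite scaleN1r addrC.
have mysp := measurable_norm_powR p mys.
have c0 : 0 <= 4 `^ p * e `^ p by rewrite mulr_ge0 ?powR_ge0.
apply: (@le_trans _ _ (\int[@lebesgue_measure R]_(t in `]0%R, T[)
   ((4 `^ p * e `^ p)%:E * (`|u t| `^ p)%:E + (g (cell T N t))%:E))%E).
  apply: ae_ge0_le_integral => //.
  - by move=> t _; rewrite adde_ge0 ?mule_ge0 ?lee_fin ?powR_ge0.
  - by apply: emeasurable_funD => //; exact: measurable_funeM.
  apply: (@filterS _ _ (ae_filter_ringOfSetsType (@lebesgue_measure R))) ys => t + It.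
  move=> /(_ It) yst; rewrite -EFinM -EFinD lee_fin.
  apply: le_trans (ge0_ler_powR (ltW p0) _ _ yst) _; rewrite ?nnegrE//.
    by rewrite !addr_ge0 ?mulr_ge0.
  apply: le_trans (powR_add4_le _ _ _ _ _) _ => //; rewrite ?mulr_ge0//; first exact: ltW.
  rewrite /g -mulrA -mulrDr !powRM// addrA.
  rewrite (_ : (K (cell T N t))%:R `^ p = (K (cell T N t))%:R) ?addrA//.
  by case: (K _); rewrite ?powR1// powR0// gt_eqF.
rewrite ge0_integralD//; last 3 first.
- by move=> t _; rewrite mule_ge0 ?lee_fin ?powR_ge0.
- exact: measurable_funeM.
- by move=> t _; rewrite lee_fin.
rewrite ge0_integralZl_EFin//.
rewrite integral_step//.
apply: (@le_trans _ _ ((4 `^ p * e `^ p)%:E * r1%:E +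
    (T / N%:R * \sum_(k < N) g k)%:E)%E).
  by apply: leeD => //; apply: lee_wpmul2l; rewrite ?lee_fin.
rewrite -EFinM -EFinD lee_fin.
rewrite -mulr_sumr !big_split/= -!mulr_sumr sumr_const card_ord -natr_sum.
set S := \sum_(i < N) `|v i| `^ p in vr *.
rewrite -[4 `^ p * _ * r1]mulrA [T / N%:R * (4 `^ p * _)]mulrCA -[leLHS]mulrDr.
rewrite ler_pM2l ?powR_gt0// -[leRHS]addrA lerD2l.
rewrite mulrDr (mulrCA _ (e `^ p)); apply: lerD.
  by rewrite ler_wpM2l ?powR_ge0.
rewrite mulrDr -[th `^ p *+ N]mulr_natl (mulrA _ N%:R) divfK ?pnatr_eq0 -?lt0n//.
by rewrite mulrCA.
Qed.

Theorem proposition2 (R : realType) (p q T : R) (p1 : 1 <= p) (q1 : 1 <= q)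
    (T0 : 0 < T) (X1 X2 X3 : completeNormedModType R)
    (i12 : {linear X1 -> X2}) (i23 : {linear X2 -> X3})
    (i12_inj : injective i12) (i23_inj : injective i23)
    (X1_reflexive : reflexive_space X1)
    (i12_compact : compact_map i12)
    (i23_continuous : continuous i23)
    (G : set (Mpq (i23 \o i12) T q p1))
    (G_bounded : M_bounded G) :
  precompact (Lp_image i12 G).
Proof.
have p0 : 0 < p := lt_le_trans ltr01 p1.
have [C1 HC1] := G_bounded; pose C := Num.max C1 0.
have C0 : 0 <= C by rewrite le_max lexx orbT.
have HC x : G x -> M_norm x <= C by move=> /HC1 xC; rewrite le_max xC.
apply: totally_bounded_simple_precompact => eps eps0.
(* The bound of Lp_step_estimate is split into three parts of size 4 ^ p * rho:
   the two terms in X1, the constant th, and the cells of large oscillation. *)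
pose rho := eps `^ p / 4 `^ p / 3.
have rho0 : 0 < rho by rewrite !divr_gt0 ?powR_gt0.
pose A := 2 * C `^ p + T.
have A0 : 0 < A by rewrite ltr_wpDl// mulr_ge0 ?powR_ge0.
have rootK c : 0 <= c -> (c `^ p^-1) `^ p = c.
  by move=> c0; rewrite -powRrM mulVf ?gt_eqF// powRr1.
pose e := (rho / A) `^ p^-1.
have e0 : 0 < e by rewrite powR_gt0// divr_gt0.
have [D D0 HD] := ehrling i23_inj i12_compact i23_continuous e0.
pose th := (rho / T) `^ p^-1.
have th0 : 0 < th by rewrite powR_gt0// divr_gt0.
(* th covers both the rounding of the values to the net and D times eta. *)
pose delta := th / 2; have delta0 : 0 < delta by rewrite divr_gt0.
pose eta := th / 2 / (D + 1).
have D1 : 0 < D + 1 by rewrite ltr_wpDl.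
have eta0 : 0 < eta by rewrite !divr_gt0.
have Deta : delta + D * eta <= th.
  rewrite [leRHS]splitr lerD2l /eta mulrCA ler_piMr ?(ltW delta0)//.
  by rewrite ler_pdivrMr// mul1r lerDl.
(* B / N bounds the contribution of the cells of large oscillation. *)
pose B := (D * C) `^ p * (T * (C `^ q / eta `^ q)).
pose N := (Num.truncn (B / rho)).+1.
have N0 : (0 < N)%N by [].
have BN : B / N%:R <= rho.
  rewrite ler_pdivrMr ?ltr0n// mulrC -ler_pdivrMr//.
  by apply: ltW; exact: truncnS_gt.
(* All sampled values lie in the ball of radius r of X1. *)
pose r := (C `^ p / (T / N%:R) + 1) `^ p^-1.
have [|V subV [cV _]] := i12_compact [set v | `|v| <= r].
  exists r; split; first exact: num_real.
  by move=> M rM v /= /le_trans; apply; exact: ltW.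
have [W HW] := compact_finite_net cV delta0.
have [F [sF HF]] := step_net p1 T0 N0 W.
exists F; split=> // y [x Gx yx].
have uC := M_norm_Lp (HC x Gx).
have xC := M_norm_BV q1 T0 (HC x Gx).
have mx : strongly_measurable T (M_Lp x) by exact: LpFun_strongly_measurable.
have [v [vr vS HK]] := step_approximation q1 T0 C0 N0 mx (M_ae x) uC xC.
have [K [KN xK]] := HK _ eta0.
have [|s sinF Hs] := HF (fun k w => `|i12 (v k) - w| < delta).
  move=> k kN; apply: HW; apply: subV; exists (v k) => //=.
  rewrite -[leLHS](_ : (`|v k| `^ p) `^ p^-1 = _).
    rewrite ge0_ler_powR ?nnegrE ?powR_ge0 ?invr_ge0 ?(ltW p0)//; last exact: vr.
    by rewrite addr_ge0// divr_ge0 ?powR_ge0// divr_ge0// ltW.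
  by rewrite -powRrM mulfV ?gt_eqF// powRr1.
exists s => //.
have my : strongly_measurable T y by exact: LpFun_strongly_measurable.
have ms : strongly_measurable T s by exact: LpFun_strongly_measurable.
have est : (\int[@lebesgue_measure R]_(t in `]0%R, T[) (`|y t - s t| `^ p)%:E <= (eps `^ p)%:E)%E.
  have Hys : {ae @lebesgue_measure R, forall t, `]0, T[%classic t -> `|y t - s t| <=
     e * `|M_Lp x t| + e * `|v (cell T N t)| + (th + D * C * (K (cell T N t))%:R)}.
    apply: (@filterS2 _ _ (ae_filter_ringOfSetsType (@lebesgue_measure R))) yx xK.
    move=> t yxt xKt It; rewrite (yxt It) /=.
    apply: le_trans (ler_distD (i12 (v (cell T N t))) _ _) _.
    have -> : i12 (M_Lp x t) - i12 (v (cell T N t)) = i12 (M_Lp x t - v (cell T N t)).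
      by rewrite linearB.
    have H1 := HD (M_Lp x t - v (cell T N t)).
    have H2 := xKt It; rewrite /= -linearB -linearB in H2.
    have H3 := ltW (Hs t It).
    have H4 := ler_normB (M_Lp x t) (v (cell T N t)).
    have H5 := ler_wpM2l D0 H2.
    have H6 := ler_wpM2l (ltW e0) H4.
    apply: le_trans (lerD (le_trans H1 (lerD H6 H5)) H3) _.
    rewrite !mulrDr; move: Deta; rewrite mulrA; lra.
  apply: le_trans (Lp_step_estimate p1 T0 N0 (ltW e0) (ltW th0) (mulr_ge0 D0 C0)
    mx my ms uC vS Hys) _.
  rewrite lee_fin.
  have -> : eps `^ p = 4 `^ p * (rho + rho + rho).
    by rewrite /rho; field; rewrite gt_eqF// powR_gt0.
  rewrite ler_pM2l ?powR_gt0// -addrA.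
  have -> : e `^ p = rho / A by rewrite rootK// divr_ge0// ltW.
  have -> : th `^ p = rho / T by rewrite rootK// divr_ge0// ltW.
  have -> : rho / A * C `^ p + (rho / A * (C `^ p + T) + (T * (rho / T) +
     (D * C) `^ p * (T / N%:R * (\sum_(k < N) K k)%:R)))
     = rho + (rho + (D * C) `^ p * (T / N%:R * (\sum_(k < N) K k)%:R)).
    rewrite addrA -mulrDr (_ : C `^ p + (C `^ p + T) = A); last by rewrite /A; ring.
    by rewrite divfK ?gt_eqF// [T * _]mulrC divfK ?gt_eqF.
  rewrite -addrA !lerD2l; apply: le_trans BN.
  have -> : B / N%:R = (D * C) `^ p * (T / N%:R * (C `^ q / eta `^ q)).
    by rewrite /B -!mulrA (mulrC N%:R^-1) -!mulrA.
  rewrite ler_wpM2l ?powR_ge0// ler_wpM2l//; first by rewrite divr_ge0// ltW.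
  by rewrite ler_pdivlMr ?powR_gt0.
have -> : y = \pi_(Lp X2 T p1)%qT (repr y) by rewrite reprK.
rewrite Lp_distE -[leRHS]/(fine eps%:E) fine_le//.
  exact: (LpFun_norm_fin (repr y - s)).
by apply: (Lp_norm_le p1 (ltW eps0)); exact: est.
Qed.
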